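(* For $n\ge 3$ let $T_n$ be the set of all 3-element sets of proper $n$-sided one-step dice in which no two of the three dice tie, and let $I_n\subseteq T_n$ be the subset of intransitive ones. Then $\lim_{n\to\infty}|I_n|/|T_n| = 1/4$.
   Context: An $n$-sided die is a non-decreasing $n$-tuple of integers. The standard die is $P_n=(1,2,\dots,n)$. For integers $a,b$ with $1\le a\le n-1$, $2\le b\le n$, $b\notin\{a,a+1\}$, $s(a,b)$ is the die obtained from $P_n$ by replacing the face with value $a$ by $a+1$ and the face with value $b$ by $b-1$ (faces then sorted); these are the proper $n$-sided one-step dice. For dice $A=(a_i)$, $B=(b_j)$, $A>B$ (''$A$ beats $B$'') means $\#\{(i,j):a_i>b_j\}>\#\{(i,j):b_j>a_i\}$ over $(i,j)\in\{1,\dots,n\}^2$; if equal, $A$ and $B$ tie. A set of three dice with no ties is intransitive if its members can be labeled $A,B,C$ with $A>B$, $B>C$, $C>A$, and transitive otherwise. *)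

(* Defs.v *)
From HB Require Import structures.
From mathcomp Require Import all_boot all_order all_algebra.
Set Implicit Arguments. Unset Strict Implicit. Unset Printing Implicit Defensive.
Import Order.TTheory GRing.Theory Num.Theory.

(* A die is a (sorted, i.e. non-decreasing) list of integer face values. *)
Definition die := seq nat.

Definition stdDie (n : nat) : die := iota 1 n.

Definition oneStep (n a b : nat) : die :=
  sort leq [seq (if x == a then a.+1 else if x == b then b.-1 else x) | x <- stdDie n].

Definition properAB (n a b : nat) : bool :=
  [&& 1 <= a, a <= n.-1, 2 <= b, b <= n, b != a & b != a.+1].

Definition properDice (n : nat) : seq die :=
  undup [seq oneStep n p.1 p.2 | p <- [seq (a, b) | a <- iota 0 n.+1, b <- iota 0 n.+1]
                               & properAB n p.1 p.2].

Definition wins (A B : die) : nat := \sum_(x <- A) \sum_(y <- B) (y < x).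

Definition beats (A B : die) : bool := wins B A < wins A B.
Definition ties (A B : die) : bool := wins A B == wins B A.

Definition PDie (n : nat) := seq_sub (properDice n).

Definition Tset (n : nat) : {set {set PDie n}} :=
  [set S : {set PDie n} | (#|S| == 3) &&
     [forall X in S, forall Y in S, (X != Y) ==> ~~ ties (val X) (val Y)]].

Definition Iset (n : nat) : {set {set PDie n}} :=
  [set S in Tset n | [exists A in S, exists B in S, exists C in S,
     [&& beats (val A) (val B), beats (val B) (val C) & beats (val C) (val A)]]].

Definition diceRatio (n : nat) : rat := (#|Iset n|%:R / #|Tset n|%:R)%R.

(* Main.v *)
Require Import Defs.
From HB Require Import structures.
From mathcomp Require Import all_boot all_order all_algebra.
From mathcomp Require Import zify ring lra.
Import Order.TTheory GRing.Theory Num.Theory.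
Local Open Scope ring_scope.

(** Put [c = b - 1] and encode [s(a, b)] by the pair [p = (a, c)]: relative to [P_n] its
    multiplicity function is [d_a - d_c], where [d_a] moves a unit of mass from [a] to
    [a + 1]. Hence the margin between two dice is bilinear in these differences, and
    swapping [a] and [c] in one die just negates all its margins. For an untied triple
    with margin signs [u, v, w] around the cycle, [1 + uv + vw + wu] is [4] if the triple
    is intransitive and [0] otherwise, so [4 |I_n| - |T_n|] is half the sum of [u v] over
    ordered untied triples [(p, q, r)], [u] and [v] being the signs for [p, q] and [q, r].
    Swapping [p], or else [r], cancels this sum except where both [p] and [r] are of the
    form [(a, a + 1)], whose swap is not a proper die. Such triples number O(n^2), since
    untied dice have adjacent coordinates, whereas [|T_n|] is at least of order n^3. *)

(** * Sums over 3-element sets as sums over ordered triples *)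

Lemma sum_uniq_triples (V : finType) (S : {set V}) :
  #|S| = 3%N ->
  (\sum_(x in S) \sum_(y in S) \sum_(z in S) uniq [:: x; y; z] = 6)%N.
Proof.
move=> S3.
rewrite (eq_bigr (fun=> 2%N)) ?sum_nat_const ?S3 // => x xS.
have Sx : #|S :\ x| = 2%N by move: S3; rewrite (cardsD1 x) xS; lia.
rewrite (bigD1 x) //= big1 ?add0n; last first.
  by move=> z _; rewrite inE eqxx.
rewrite (eq_bigl (fun y => y \in S :\ x)); last by move=> y; rewrite !inE andbC.
rewrite (eq_bigr (fun=> 1%N)) ?sum_nat_const ?Sx // => y yS.
have Sxy : #|S :\ x :\ y| = 1%N by move: Sx; rewrite (cardsD1 y) yS; lia.
rewrite -Sxy -sum1_card big_mkcond [RHS]big_mkcond /=.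
apply: eq_bigr => z _; move: yS; rewrite !inE negb_or andbT => /andP[yx _].
rewrite [x == y]eq_sym yx /= [x == z]eq_sym [y == z]eq_sym.
by case: (z \in S); case: (z == x); case: (z == y).
Qed.

(** Double counting: every 3-element set has six orderings. Keeping the factor 6 on the left keeps
    the identity inside [int]. *)
Lemma sum_card3_triples (V : finType) (F : {set V} -> int) :
  6 * \sum_(S : {set V} | #|S| == 3%N) F S =
  \sum_x \sum_y \sum_z (uniq [:: x; y; z])%:R * F [set x; y; z].
Proof.
pose m (S : {set V}) x y z : int :=
  ((x \in S) && (y \in S) && (z \in S) && uniq [:: x; y; z])%:R.
have E6 (S : {set V}) : #|S| == 3%N -> 6 * F S = \sum_x \sum_y \sum_z m S x y z * F S.
  move=> /eqP /sum_uniq_triples E.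
  transitivity ((\sum_x \sum_y \sum_z m S x y z) * F S); last first.
    rewrite mulr_suml; apply: eq_bigr => x _.
    by rewrite mulr_suml; apply: eq_bigr => y _; rewrite mulr_suml.
  congr (_ * _); rewrite -[6]/(6%N%:R) -E natr_sum [LHS]big_mkcond.
  apply: eq_bigr => x _ /=; rewrite /m.
  case: (x \in S) => /=; last by rewrite big1 // => y _; rewrite big1.
  rewrite natr_sum [LHS]big_mkcond; apply: eq_bigr => y _ /=.
  case: (y \in S) => /=; last by rewrite big1.
  by rewrite natr_sum [LHS]big_mkcond; apply: eq_bigr => z _ /=; case: (z \in S).
rewrite mulr_sumr (eq_bigr _ E6) exchange_big; apply: eq_bigr => x _.
rewrite exchange_big; apply: eq_bigr => y _.
rewrite exchange_big; apply: eq_bigr => z _.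
case: (boolP (uniq [:: x; y; z])) => [u|nu]; last first.
  by rewrite mul0r big1 // => S _; rewrite /m (negPf nu) andbF mul0r.
have c3 : #|[set x; y; z]| = 3%N.
  move: (u); rewrite /= !inE negb_or andbT => /andP[/andP[xy xz] yz].
  by rewrite setUC cardsU1 cards2 !inE xy negb_or ![z == _]eq_sym xz yz.
(* For distinct [x], [y], [z], a 3-element set containing all three can only be [[set x; y; z]]. *)
rewrite (bigD1 [set x; y; z]) ?c3 //= big1 ?addr0.
  by rewrite /m !inE !eqxx !orbT u.
move=> S /andP[/eqP S3 neS]; rewrite /m u andbT.
case: (boolP (_ && _)) => [/andP[/andP[xS yS] zS]|_]; last by rewrite mul0r.
case/eqP: neS; apply/esym/eqP; rewrite eqEcard c3 S3 andbT.
by apply/subsetP => t; rewrite !inE => /orP[/orP[]|] /eqP->.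
Qed.

(** * Cyclic triples in a tournament with ties *)

Section Tournament.
Context (V : finType) (d : V -> V -> int).
Hypothesis dA : forall x y, d x y = - d y x.

Definition untied3 : {set {set V}} :=
  [set S : {set V} | (#|S| == 3%N) &&
     [forall X in S, forall Y in S, (X != Y) ==> (d X Y != 0)]].

Definition cyclic3 : {set {set V}} :=
  [set S in untied3 | [exists A in S, exists B in S, exists C in S,
     [&& 0 < d A B, 0 < d B C & 0 < d C A]]].

Local Notation s x y := (sgz (d x y)).

Lemma diag0 x : d x x = 0.
Proof. by have := dA x x; lia. Qed.

(** Since [d] vanishes on the diagonal, nonzero margins already force distinctness, so in sums over
    triples [uniq] can be absorbed into the signs. *)
Lemma in_untied3 x y z :
  (uniq [:: x; y; z] && ([set x; y; z] \in untied3)) =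
  [&& d x y != 0, d y z != 0 & d z x != 0].
Proof.
apply/andP/and3P => [[u]|[xy yz zx]].
  rewrite inE => /andP[_ /forall_inP H].
  move: u; rewrite /= !inE negb_or andbT => /andP[/andP[xy xz] yz].
  have {}H a b : a \in [set x; y; z] -> b \in [set x; y; z] -> a != b -> d a b != 0.
    by move=> /H/forall_inP{}H /H/implyP.
  by split; apply: H; rewrite ?inE ?eqxx ?orbT // eq_sym.
have ne a b : d a b != 0 -> a != b by apply: contraNneq => ->; rewrite diag0.
have u : uniq [:: x; y; z].
  by rewrite /= !inE negb_or (ne _ _ xy) eq_sym (ne _ _ zx) (ne _ _ yz).
split=> //; rewrite inE; apply/andP; split.
  move: (u); rewrite /= !inE negb_or andbT => /andP[/andP[xy' xz] yz'].
  by rewrite setUC cardsU1 cards2 !inE xy' negb_or ![z == _]eq_sym xz yz'.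
have yx : d y x != 0 by rewrite dA oppr_eq0.
have zy : d z y != 0 by rewrite dA oppr_eq0.
have xz : d x z != 0 by rewrite dA oppr_eq0.
apply/forall_inP => a aS; apply/forall_inP => b bS; apply/implyP.
by move: aS bS; rewrite !inE => /orP[/orP[]|]/eqP-> /orP[/orP[]|]/eqP->; rewrite ?eqxx.
Qed.

(** The two disjuncts are the two orientations of a 3-cycle on the same set. *)
Lemma in_cyclic3 x y z : [set x; y; z] \in untied3 ->
  ([set x; y; z] \in cyclic3) =
  [&& 0 < d x y, 0 < d y z & 0 < d z x] || [&& d x y < 0, d y z < 0 & d z x < 0].
Proof.
move=> tS; rewrite inE tS /=.
have xx := diag0 x; have yy := diag0 y; have zz := diag0 z.
have xy := dA x y; have yz := dA y z; have zx := dA z x.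
apply/idP/idP.
  case/exists_inP => a aS /exists_inP[b bS] /exists_inP[c cS] /and3P[].
  move: aS bS cS; rewrite !inE.
  by do 3![move=> /orP[/orP[]|]/eqP->]; lia.
move=> H.
have xS : x \in [set x; y; z] by rewrite !inE eqxx.
have yS : y \in [set x; y; z] by rewrite !inE eqxx orbT.
have zS : z \in [set x; y; z] by rewrite !inE eqxx orbT.
case/orP: H => H.
  by apply/exists_inP; exists x => //; apply/exists_inP; exists y => //;
     apply/exists_inP; exists z.
apply/exists_inP; exists x => //; apply/exists_inP; exists z => //.
by apply/exists_inP; exists y => //; lia.
Qed.

(** The squared product of the three signs is the 0/1 indicator of an untied triple. *)
Lemma card_untied3 :
  6 * #|untied3|%:R = \sum_x \sum_y \sum_z (s x y * s y z * s z x) ^+ 2.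
Proof.
have -> : #|untied3|%:R = \sum_(S : {set V} | #|S| == 3%N) (S \in untied3)%:R :> int.
  rewrite -sum1_card natr_sum big_mkcond [RHS]big_mkcond; apply: eq_bigr => S _.
  by rewrite inE; case: (_ == _) => //=; case: ifP.
rewrite sum_card3_triples; do 3!(apply: eq_bigr => ? _).
rewrite -natrM mulnb in_untied3.
by do 3!case: sgzP => _.
Qed.

(* [1 + uv + vw + wu] is [4] if the signs [u, v, w] agree and [0] otherwise; the
   three products have the same sum by cyclic relabelling of the triple. *)
Lemma card_cyclic3 :
  24 * #|cyclic3|%:R =
  6 * #|untied3|%:R + 3 * \sum_x \sum_y \sum_z s x y * s y z * s z x ^+ 2.
Proof.
have -> : #|cyclic3|%:R = \sum_(S : {set V} | #|S| == 3%N) (S \in cyclic3)%:R :> int.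
  rewrite -sum1_card natr_sum big_mkcond [RHS]big_mkcond; apply: eq_bigr => S _.
  by rewrite 2!inE; case: (_ == _) => //=; case: ifP.
rewrite card_untied3 (_ : 24 = 4 * 6) // -mulrA sum_card3_triples.
pose f x y z : int := s x y * s y z * s z x ^+ 2.
have rot (g : V -> V -> V -> int) :
    \sum_x \sum_y \sum_z g x y z = \sum_x \sum_y \sum_z g y z x.
  by rewrite [RHS]exchange_big; apply: eq_bigr => x _; rewrite [RHS]exchange_big.
have -> : 3 * \sum_x \sum_y \sum_z f x y z =
    \sum_x \sum_y \sum_z (f x y z + f y z x + f z x y).
  under [RHS]eq_bigr => x _ do
    (under eq_bigr => y _ do rewrite !big_split /=; rewrite !big_split /=).
  rewrite !big_split /= -(rot f) -(rot (fun x y z => f y z x)) -(rot f).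
  by ring.
rewrite mulr_sumr -big_split; apply: eq_bigr => x _ /=.
rewrite mulr_sumr -big_split; apply: eq_bigr => y _ /=.
rewrite mulr_sumr -big_split; apply: eq_bigr => z _ /=.
rewrite -natrM mulnb /f.
have /= := in_untied3 x y z; have := in_cyclic3 x y z.
have : [set x; y; z] \in cyclic3 -> [set x; y; z] \in untied3 by rewrite inE => /andP[].
case: (_ \in untied3) => [_ /(_ isT)->|H _]; last first.
  case: (_ \in cyclic3) H => [/(_ isT)//|_]; rewrite !andbF.
  by do 3!case: sgzP => _.
by rewrite andbT => ->; do 3!case: sgzP => _.
Qed.

End Tournament.

(** * Margins between one-step dice *)

Definition margin (A B : die) : int := (wins A B)%:Z - (wins B A)%:Z.

Definition cmp (x y : nat) : int := (y < x)%N%:R - (x < y)%N%:R.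

(* The second difference of the sign function [cmp], see [kinkE]. *)
Definition kink (x y : nat) : int := (x == y.+1)%:R - (y == x.+1)%:R.

Lemma marginA A B : margin A B = - margin B A.
Proof. by rewrite /margin opprB. Qed.

Lemma marginE A B : margin A B = \sum_(x <- A) \sum_(y <- B) cmp x y.
Proof.
rewrite /margin /wins [X in _ - Posz X]exchange_big -!natz !natr_sum -sumrB.
by apply: eq_bigr => x _; rewrite !natr_sum -sumrB.
Qed.

Lemma sum_iota_pick n (a : nat) (v : int) :
  (0 < a <= n)%N -> \sum_(x <- iota 1 n) (x == a)%:R * v = v.
Proof.
move=> an; rewrite (bigD1_seq a) ?iota_uniq ?mem_iota //=.
by rewrite eqxx mul1r big1 ?addr0 // => x /negPf->; rewrite mul0r.
Qed.

Lemma sum_oneStep n a c (f : nat -> int) :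
    (0 < a < n)%N -> (0 < c < n)%N -> a != c -> a != c.+1 ->
  \sum_(x <- oneStep n a c.+1) f x =
  \sum_(x <- iota 1 n) f x + (f a.+1 - f a) - (f c.+1 - f c).
Proof.
move=> an cn ac acS; rewrite /oneStep (perm_big _ (permEl (perm_sort _ _))) big_map.
rewrite -[f a.+1 - f a](@sum_iota_pick n a); last by lia.
rewrite -[X in _ = _ - X](@sum_iota_pick n c.+1); last by lia.
rewrite -big_split -sumrB; apply: eq_bigr => x _ /=.
have [->|xa] := eqVneq x a; first by rewrite (negPf acS) mul1r mul0r; ring.
by have [->|xc] := eqVneq x c.+1; rewrite ?mul1r ?mul0r; ring.
Qed.

(** Raising a face from [a] to [a + 1] turns one tie into a win and one loss into a tie. The gain
    does not depend on [a], which is why one-step dice tie with [P_n]. *)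
Lemma sum_cmp_step n a : (0 < a < n)%N ->
  \sum_(x <- iota 1 n) (cmp a.+1 x - cmp a x) = 2.
Proof.
move=> an; transitivity (\sum_(x <- iota 1 n) ((x == a)%:R * 1 + (x == a.+1)%:R * 1 : int)).
  by apply: eq_bigr => x _; rewrite /cmp; lia.
by rewrite big_split /= !sum_iota_pick //; lia.
Qed.

Lemma cmpA x y : cmp x y = - cmp y x.
Proof. by rewrite /cmp opprB. Qed.

Lemma kinkE a b :
  (cmp a.+1 b.+1 - cmp a b.+1) - (cmp a.+1 b - cmp a b) = kink a b.
Proof. by rewrite /cmp /kink; lia. Qed.

(** Expand bilinearly: [P_n] against itself gives 0 by antisymmetry, the cross terms with [P_n]
    cancel as [2 - 2], and the four remaining second differences of [cmp] are kinks. *)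
Lemma margin_oneStep n a c a' c' :
    (0 < a < n)%N -> (0 < c < n)%N -> a != c -> a != c.+1 ->
    (0 < a' < n)%N -> (0 < c' < n)%N -> a' != c' -> a' != c'.+1 ->
  margin (oneStep n a c.+1) (oneStep n a' c'.+1) =
  kink a a' - kink a c' - kink c a' + kink c c'.
Proof.
move=> an cn ac acS an' cn' ac' acS'; rewrite marginE.
rewrite sum_oneStep // !sum_oneStep //.
under eq_bigr do rewrite sum_oneStep //.
have P0 : \sum_(x <- iota 1 n) \sum_(y <- iota 1 n) cmp x y = 0.
  have : \sum_(x <- iota 1 n) \sum_(y <- iota 1 n) cmp x y =
     - \sum_(x <- iota 1 n) \sum_(y <- iota 1 n) cmp x y.
    rewrite [in RHS]exchange_big -sumrN; apply: eq_bigr => x _.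
    by rewrite -sumrN; apply: eq_bigr => y _; rewrite cmpA.
  by lia.
have Pr b : (0 < b < n)%N ->
    \sum_(x <- iota 1 n) cmp b.+1 x = \sum_(x <- iota 1 n) cmp b x + 2.
  by move=> /sum_cmp_step <-; rewrite [X in _ + X]sumrB addrC subrK.
have Pl b : (0 < b < n)%N ->
    \sum_(x <- iota 1 n) (cmp x b.+1 - cmp x b) = - 2.
  move=> /sum_cmp_step <-; rewrite -sumrN; apply: eq_bigr => x _.
  by rewrite (cmpA x) (cmpA x b); ring.
rewrite [X in X + _ - _]sumrB [X in X - _ + _ - _]big_split /= P0 !Pr // !Pl // -!kinkE; ring.
Qed.

(* The conditions on [s(a, b)] in terms of [a] and [c = b - 1]. *)
Definition proper_ac (a c : nat) := [&& 0 < a, 0 < c, a != c & a != c.+1]%N.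

(** The number of faces at most [k] differs from that of [P_n] by [[c = k] - [a = k]]; taking
    [k = a] and [k = c] recovers the pair. *)
Lemma oneStep_inj n a c a' c' :
    (a < n)%N -> (c < n)%N -> proper_ac a c ->
    (a' < n)%N -> (c' < n)%N -> proper_ac a' c' ->
  oneStep n a c.+1 = oneStep n a' c'.+1 -> a = a' /\ c = c'.
Proof.
move=> an cn /and4P[a0 c0 ac acS] an' cn' /and4P[a0' c0' ac' acS'] E.
have H k : ((a == k)%:R - (c == k)%:R = (a' == k)%:R - (c' == k)%:R :> int).
  have : \sum_(x <- oneStep n a c.+1) (x <= k)%N%:R =
         \sum_(x <- oneStep n a' c'.+1) (x <= k)%N%:R :> int by rewrite E.
  by rewrite !sum_oneStep ?a0 ?c0 ?a0' ?c0' //; lia.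
have /negPf ca : c != a by rewrite eq_sym.
split; first by have := H a; rewrite eqxx ca; case: (a' =P a) => // _; case: (c' == a).
by have := H c; rewrite eqxx (negPf ac); case: (c' =P c) => // _; case: (a' == c).
Qed.

(** * One-step dice as pairs of ordinals *)

Section Edges.
Variable n : nat.

(** Properness excludes the ordinal 0, which leaves [1, ..., n - 1], the range of both [a] and
    [c = b - 1]. *)
Definition edge := ('I_n * 'I_n)%type.
Implicit Types p q r : edge.

Definition proper_edge p := proper_ac p.1 p.2.
Definition edge_die p : die := oneStep n p.1 p.2.+1.
Definition edge_margin p q : int :=
  kink p.1 q.1 - kink p.1 q.2 - kink p.2 q.1 + kink p.2 q.2.

Lemma margin_edge p q : proper_edge p -> proper_edge q ->
  margin (edge_die p) (edge_die q) = edge_margin p q.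
Proof.
move=> /and4P[? ? ? ?] /and4P[? ? ? ?]; apply: margin_oneStep; rewrite ?ltn_ord ?andbT //.
Qed.

Lemma edge_die_inj : {in proper_edge &, injective edge_die}.
Proof.
move=> [a c] [a' c'] pp qq E.
have [] := oneStep_inj _ _ _ _ _ (ltn_ord a) (ltn_ord c) pp (ltn_ord a') (ltn_ord c') qq E.
by move=> /val_inj -> /val_inj ->.
Qed.

Lemma mem_properDice A :
  (A \in properDice n) = (A \in [seq edge_die p | p <- enum {: edge} & proper_edge p]).
Proof.
rewrite mem_undup; apply/mapP/mapP => [[[a b]]|[[a c]]]; rewrite mem_filter.
  case/andP=> /= /and5P[a0 an b2 bn /andP[ba baS]] _ ->.
  have an' : (a < n)%N by lia.
  have bn' : (b.-1 < n)%N by lia.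
  exists (Ordinal an', Ordinal bn').
    by rewrite mem_filter mem_enum andbT /proper_edge /proper_ac /=; lia.
  by rewrite /edge_die /= prednK //; lia.
case/andP=> /and4P[a0 c0 ac acS] _ ->; simpl in a0, c0, ac, acS.
exists (nat_of_ord a, c.+1) => //; rewrite mem_filter.
have := ltn_ord a; have := ltn_ord c => cn an.
apply/andP; split; first by rewrite /properAB /=; lia.
by apply/allpairsPdep; exists (nat_of_ord a), c.+1; split; rewrite // mem_iota; lia.
Qed.

Lemma sum_PDie (F : die -> int) :
  \sum_(A : PDie n) F (val A) = \sum_(p | proper_edge p) F (edge_die p).
Proof.
transitivity (\sum_(A <- [seq val A | A <- index_enum (PDie n)]) F A).
  by rewrite big_map.
transitivity (\sum_(A <- [seq edge_die p | p <- enum {: edge} & proper_edge p]) F A); last first.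
  by rewrite big_map big_filter big_enum_cond.
apply: perm_big; apply: uniq_perm.
- by rewrite map_inj_uniq ?index_enum_uniq //; apply: val_inj.
- rewrite map_inj_in_uniq ?filter_uniq -?enumT ?enum_uniq // => p q.
  by rewrite !mem_filter => /andP[? _] /andP[? _]; apply: edge_die_inj.
move=> A; rewrite -mem_properDice; apply/mapP/idP => [[B _ ->]|AD].
  exact: valP.
by exists (Sub A AD); rewrite ?SubK ?mem_index_enum.
Qed.
End Edges.

(** * Bounds for sums of kinks *)

Lemma ler_norm_sgz (x : int) : `|sgz x| <= `|x|.
Proof. by case: sgzP => // ?; lia. Qed.

Lemma sum_ord_eq_le1 n (i : nat) : \sum_(a < n) (a == i :> nat)%:R <= 1 :> int.
Proof.
have [lt_in|le_ni] := ltnP i n.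
  rewrite (bigD1 (Ordinal lt_in)) //= eqxx big1 ?addr0 // => a.
  by rewrite -val_eqE /= => /negPf->.
by rewrite big1 // => a _; have := ltn_ord a; case: eqVneq => // ->; lia.
Qed.

Lemma sum_ord_eqS_le1 n (i c : nat) : \sum_(a < n) (i == a + c)%N%:R <= 1 :> int.
Proof.
apply: le_trans (sum_ord_eq_le1 n (i - c)); apply: ler_sum => a _.
by rewrite ler_nat; lia.
Qed.

Lemma normr_kink x y : `|kink x y| <= (x == y.+1)%:R + (y == x.+1)%:R.
Proof. by rewrite /kink; lia. Qed.

Lemma kinkA x y : kink x y = - kink y x.
Proof. by rewrite /kink opprB. Qed.

Lemma sum_kinkl n i c : \sum_(a < n) `|kink (a + c) i| <= 2.
Proof.
(* Truncation in [i.+1 - c] is harmless: only an upper bound is wanted, and [a + c = i + 1] still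
   implies [a = i.+1 - c]. *)
have : \sum_(a < n) `|kink (a + c) i| <=
    \sum_(a < n) ((a == (i.+1 - c)%N :> nat)%:R + (i == (a + c.+1)%N)%:R).
  by apply: ler_sum => a _; apply: le_trans (normr_kink _ _) _; lia.
move=> /le_trans; apply; rewrite big_split -[2]/(1 + 1 : int).
by apply: lerD; [apply: sum_ord_eq_le1 | apply: sum_ord_eqS_le1].
Qed.

Lemma sum_kinkr n i c : \sum_(a < n) `|kink i (a + c)| <= 2.
Proof. by under eq_bigr do rewrite kinkA normrN; apply: sum_kinkl. Qed.

(** * Cancellation under swapping the coordinates of a pair *)

Section SwapCancellation.
Variable n : nat.
Implicit Types p q r : edge n.
Local Notation s p q := (sgz (edge_margin n p q)).
Local Notation ok := (proper_edge n).

Definition swap p : edge n := (p.2, p.1).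

Lemma swapK : involutive swap.
Proof. by case. Qed.

Lemma edge_margin_swapl p q : edge_margin n (swap p) q = - edge_margin n p q.
Proof. by rewrite /edge_margin /=; ring. Qed.

Lemma edge_marginA p q : edge_margin n p q = - edge_margin n q p.
Proof.
rewrite /edge_margin (kinkA p.1 q.1) (kinkA p.1 q.2) (kinkA p.2 q.1) (kinkA p.2 q.2).
by ring.
Qed.

Lemma edge_margin_swapr p q : edge_margin n p (swap q) = - edge_margin n p q.
Proof. by rewrite edge_marginA edge_margin_swapl opprK edge_marginA. Qed.

Lemma unswappableE p : ok p && ~~ ok (swap p) -> p.2 = p.1.+1 :> nat.
Proof. by rewrite /proper_edge /proper_ac /=; lia. Qed.

(** The involution [swap] preserves the set of [p] with both [p] and [swap p] proper, so an odd
    function sums to zero there. *)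
Lemma sum_swap_odd (g : edge n -> int) : (forall p, g (swap p) = - g p) ->
  \sum_(p | ok p) g p = \sum_(p | ok p && ~~ ok (swap p)) g p.
Proof.
move=> gN; rewrite (bigID (fun p => ok (swap p))) /= -[RHS]add0r; congr (_ + _).
set S := LHS; suff : S = - S by lia.
rewrite {1}/S (reindex_inj (inv_inj swapK)) -sumrN.
by apply: eq_big => [p|p _]; rewrite ?swapK 1?andbC.
Qed.

(** Each of the four kinks fixes one coordinate of [q] up to two choices and leaves the other free,
    contributing at most [2 * n]. *)
Lemma sum_margin_le p : \sum_(q : edge n) `|edge_margin n p q| <= 8 * n%:R.
Proof.
have K i : \sum_(q : edge n) `|kink i q.1| <= 2 * n%:R.
  rewrite -(pair_big xpredT xpredT (fun a b : 'I_n => `|kink i a|)) /=.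
  under eq_bigr do rewrite sumr_const card_ord -mulr_natr.
  rewrite -mulr_suml ler_wpM2r //; have := sum_kinkr n i 0.
  by under eq_bigr do rewrite addn0.
have K' i : \sum_(q : edge n) `|kink i q.2| <= 2 * n%:R.
  by rewrite (reindex_inj (inv_inj swapK)); apply: K.
have := K p.1; have := K' p.1; have := K p.2; have := K' p.2.
have : \sum_(q : edge n) `|edge_margin n p q| <= \sum_(q : edge n)
   (`|kink p.1 q.1| + `|kink p.1 q.2| + `|kink p.2 q.1| + `|kink p.2 q.2|).
  by apply: ler_sum => q _; rewrite /edge_margin; lia.
by rewrite !big_split /=; lra.
Qed.

(** Here [r = (a, a + 1)] is determined by [a], so each of the four kinks is summed over a single
    index and contributes at most 2. *)
Lemma sum_unswappable_le p :
  \sum_(r | ok r && ~~ ok (swap r)) `|edge_margin n r p| <= 8.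
Proof.
pose g (a : nat) : int := `|kink a p.1| + `|kink a p.2| + `|kink (a + 1) p.1| + `|kink (a + 1) p.2|.
have : \sum_(r | ok r && ~~ ok (swap r)) `|edge_margin n r p| <= \sum_(a < n) g a.
  rewrite big_mkcond -(pair_big xpredT xpredT (fun a b : 'I_n =>
    if ok (a, b) && ~~ ok (swap (a, b)) then `|edge_margin n (a, b) p| else 0)) /=.
  apply: ler_sum => a _.
  have g0 : 0 <= g a by rewrite !addr_ge0.
  have [b0 /unswappableE/= b0E|nob] := pickP (fun b : 'I_n => ok (a, b) && ~~ ok (swap (a, b))); last first.
    by rewrite big1 // => b _; rewrite nob.
  rewrite (bigD1 b0) //= big1 ?addr0 => [|b bb0].
    case: ifP => // _; rewrite /edge_margin /g /= b0E addn1; lia.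
  case: ifP => // /unswappableE /= bE; case/eqP: bb0; apply: val_inj; rewrite /= bE b0E //.
have k0 y : \sum_(a < n) `|kink a y| <= 2.
  by have := sum_kinkl n y 0; under eq_bigr do rewrite addn0.
move=> /le_trans; apply; rewrite /g !big_split /=.
have := k0 p.1; have := k0 p.2; have := sum_kinkl n p.1 1; have := sum_kinkl n p.2 1.
by lra.
Qed.

Lemma card_unswappable_le : \sum_(p : edge n | ok p && ~~ ok (swap p)) 1 <= n%:R :> int.
Proof.
rewrite sumr_const ler_nat -[leqRHS]card_ord -(@card_in_image _ _ (fun p : edge n => p.1)).
  exact: max_card.
move=> [a b] [a' b'] /unswappableE /= bE /unswappableE /= bE' aa'; rewrite -aa' in bE' *.
by congr (_, _); apply: val_inj; rewrite /= bE bE'.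
Qed.

(* Swapping [p] negates [s p q] and fixes [s q r] and [s r p ^+ 2]; likewise for [r].
   Only triples in which neither [p] nor [r] can be swapped survive. *)
Lemma sum_sign_paths_le :
  `|\sum_(p | ok p) \sum_(q | ok q) \sum_(r | ok r) s p q * s q r * s r p ^+ 2|
    <= 64 * n%:R ^+ 2.
Proof.
rewrite sum_swap_odd => [|p]; last first.
  rewrite -sumrN; apply: eq_bigr => q _; rewrite -sumrN; apply: eq_bigr => r _.
  by rewrite edge_margin_swapl edge_margin_swapr !sgzN sqrrN !mulNr.
(* Moving [r] outside [q] lets the second swap act on [r] with [p] already restricted. *)
under eq_bigr do rewrite exchange_big.
rewrite /=.
under eq_bigr => p _.
  rewrite sum_swap_odd => [|r]; last first.
    rewrite -sumrN; apply: eq_bigr => q _.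
    by rewrite edge_margin_swapl edge_margin_swapr !sgzN sqrrN mulrN mulNr.
  over.
apply: le_trans (ler_norm_sum _ _ _) _.
have bound p : ok p && ~~ ok (swap p) ->
    `|\sum_(r | ok r && ~~ ok (swap r)) \sum_(q | ok q) s p q * s q r * s r p ^+ 2|
      <= 64 * n%:R * 1.
  move=> _; apply: le_trans (ler_norm_sum _ _ _) _.
  (* For fixed [p], the unswappable [r] contribute 8 and the [q] contribute [8 * n]; the at most [n]
     choices of [p] come last. *)
  have : \sum_(r | ok r && ~~ ok (swap r)) `|edge_margin n r p| * (8 * n%:R) <= 64 * n%:R * 1.
    have := sum_unswappable_le p; rewrite -mulr_suml => /(@ler_wpM2r _ (8 * n%:R)) H.
    by apply: le_trans (H _) _; [rewrite mulr_ge0 | lia].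
  apply: le_trans; apply: ler_sum => r _.
  apply: le_trans (ler_norm_sum _ _ _) _.
  apply: le_trans (ler_wpM2l (normr_ge0 _) (sum_margin_le p)).
  rewrite mulr_sumr [leLHS]big_mkcond; apply: ler_sum => q _.
  case: ifP => _; last by rewrite mulr_ge0.
  (* One factor [s r p] and the factor [s p q] are bounded by their margins, the other signs by
     1. *)
  have small (x : int) : `|sgz x| <= 1 by case: sgzP.
  rewrite !normrM mulrC.
  apply: ler_pM; rewrite ?mulr_ge0 //.
    by rewrite -[leRHS]mulr1 ler_pM // ler_norm_sgz.
  by rewrite -[leRHS]mulr1 ler_pM // ler_norm_sgz.
apply: le_trans (ler_sum _ bound) _.
rewrite -mulr_sumr expr2 mulrA ler_wpM2l ?mulr_ge0 //.
exact: card_unswappable_le.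
Qed.
End SwapCancellation.

(** * The counts for [Tset] and [Iset] *)

Lemma Tset_untied3 n : Tset n = untied3 (PDie n) (fun A B => margin (val A) (val B)).
Proof.
apply: eq_finset => S; congr (_ && _).
apply: eq_forallb_in => A _; apply: eq_forallb_in => B _.
by rewrite /ties /margin subr_eq0 eqz_nat.
Qed.

Lemma Iset_cyclic3 n : Iset n = cyclic3 (PDie n) (fun A B => margin (val A) (val B)).
Proof.
apply/setP => S; rewrite inE [RHS]inE Tset_untied3; congr (_ && _).
apply: eq_existsb => A; congr (_ && _); apply: eq_existsb => B; congr (_ && _).
apply: eq_existsb => C; congr (_ && _).
by rewrite /beats /margin !subr_gt0 !ltz_nat.
Qed.

Lemma sum3_PDie n (F : die -> die -> die -> int) :
  \sum_(A : PDie n) \sum_(B : PDie n) \sum_(C : PDie n) F (val A) (val B) (val C) =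
  \sum_(p | proper_edge n p) \sum_(q | proper_edge n q) \sum_(r | proper_edge n r)
    F (edge_die n p) (edge_die n q) (edge_die n r).
Proof.
rewrite (sum_PDie n (fun A => \sum_(B : PDie n) \sum_(C : PDie n) F A (val B) (val C))).
apply: eq_bigr => p _.
rewrite (sum_PDie n (fun B => \sum_(C : PDie n) F (edge_die n p) B (val C))).
by apply: eq_bigr => q _; rewrite sum_PDie.
Qed.

Lemma card_Tset n : 6 * #|Tset n|%:R =
  \sum_(p | proper_edge n p) \sum_(q | proper_edge n q) \sum_(r | proper_edge n r)
    (sgz (edge_margin n p q) * sgz (edge_margin n q r) * sgz (edge_margin n r p)) ^+ 2.
Proof.
rewrite Tset_untied3 card_untied3 => [|A B]; last exact: marginA.
rewrite (sum3_PDie n (fun A B C =>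
  (sgz (margin A B) * sgz (margin B C) * sgz (margin C A)) ^+ 2)).
by do 3!(apply: eq_bigr => ? ?); rewrite !margin_edge.
Qed.

(** The signed sum equals [8 |I_n| - 2 |T_n|], so its bound 64 is halved to 32. *)
Lemma card_Iset_Tset n : `|4 * #|Iset n|%:R - #|Tset n|%:R| <= 32 * n%:R ^+ 2 :> int.
Proof.
have := sum_sign_paths_le n.
have -> : \sum_(p | proper_edge n p) \sum_(q | proper_edge n q) \sum_(r | proper_edge n r)
   sgz (edge_margin n p q) * sgz (edge_margin n q r) * sgz (edge_margin n r p) ^+ 2 =
   8 * #|Iset n|%:R - 2 * #|Tset n|%:R.
  suff : 24 * #|Iset n|%:R = 6 * #|Tset n|%:R + 3 * \sum_(p | proper_edge n p)
    \sum_(q | proper_edge n q) \sum_(r | proper_edge n r)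
    sgz (edge_margin n p q) * sgz (edge_margin n q r) * sgz (edge_margin n r p) ^+ 2 by lra.
  rewrite Iset_cyclic3 Tset_untied3 card_cyclic3 => [|A B]; last exact: marginA.
  congr (_ + 3 * _).
  rewrite (sum3_PDie n (fun A B C =>
    sgz (margin A B) * sgz (margin B C) * sgz (margin C A) ^+ 2)).
  by do 3!(apply: eq_bigr => ? ?); rewrite !margin_edge.
by lia.
Qed.

(* Witnesses: the dice [(x, y)], [(x + 1, z)], [(y + 1, z + 1)] with [x], [y], [z] far apart. *)
Lemma card_Tset_ge n k : (3 * k + 11 <= n)%N -> (k ^ 3 <= 6 * #|Tset n|)%N.
Proof.
move=> kn; case: n kn => [|n] kn; first by lia.
(* The values lie in [[1, k]], [[k + 4, 2k + 3]] and [[2k + 8, 3k + 7]]. The gaps leave exactly one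
   adjacency, hence one nonzero kink, between any two of the dice. *)
pose x (i : 'I_k) := i.+1; pose y (i : 'I_k) := (i + k + 4)%N; pose z (i : 'I_k) := (i + 2 * k + 8)%N.
pose e a c : edge n.+1 := (inord a, inord c).
pose h (t : 'I_k * 'I_k * 'I_k) : edge n.+1 * edge n.+1 * edge n.+1 :=
  (e (x t.1.1) (y t.1.2), e (x t.1.1).+1 (z t.2), e (y t.1.2).+1 (z t.2).+1).
pose P (t : edge n.+1 * edge n.+1 * edge n.+1) :=
  [&& proper_edge n.+1 t.1.1, proper_edge n.+1 t.1.2, proper_edge n.+1 t.2,
   edge_margin n.+1 t.1.1 t.1.2 != 0, edge_margin n.+1 t.1.2 t.2 != 0
   & edge_margin n.+1 t.2 t.1.1 != 0].
have -> : (6 * #|Tset n.+1| = #|P|)%N.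
  apply/eqP; rewrite -eqz_nat -!natz natrM card_Tset.
  have -> : #|P|%:R = \sum_p \sum_q \sum_r if P (p, q, r) then 1 else 0 :> int.
    rewrite !pair_bigA /= -sum1_card natr_sum big_mkcond.
    by apply: eq_bigr => [[[p q] r]] _.
  apply/eqP; rewrite [LHS]big_mkcond; apply: eq_bigr => p _.
  rewrite /P /=; case: (proper_edge _ p) => /=; last by rewrite big1 // => q _; rewrite big1.
  rewrite [LHS]big_mkcond; apply: eq_bigr => q _.
  case: (proper_edge _ q) => /=; last by rewrite big1.
  rewrite [LHS]big_mkcond; apply: eq_bigr => r _.
  by case: (proper_edge _ r) => //=; do 3!case: sgzP => ?.
have ev a c : (a <= n)%N -> (c <= n)%N -> ((e a c).1 = a :> nat) * ((e a c).2 = c :> nat).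
  by move=> an cn; rewrite /e /= !inordK.
have hinj : injective h.
  move=> [[i1 i2] i3] [[j1 j2] j3] [] /(congr1 val) /= E1 /(congr1 val) /= E2 _ /(congr1 val) /= E3 _ _.
  have := (ltn_ord i1, ltn_ord i2, ltn_ord i3, (ltn_ord j1, ltn_ord j2, ltn_ord j3)).
  move=> [[[? ?] ?] [[? ?] ?]].
  move: E1 E2 E3; rewrite !inordK /x /y /z; try lia.
  by move=> E1 E2 E3; congr (_, _, _); apply: val_inj => /=; lia.
have -> : (k ^ 3 = #|codom h|)%N by rewrite card_codom // !card_prod card_ord; lia.
apply: subset_leq_card; apply/subsetP => _ /codomP[[[i j] l] ->].
have := (ltn_ord i, ltn_ord j, ltn_ord l) => -[[li lj] ll].
suff : P (h (i, j, l)) by [].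
rewrite /P /h /= /proper_edge /edge_margin /proper_ac !ev /x /y /z; try lia.
by rewrite /kink /=; do 5?[apply/andP; split]; lia.
Qed.

(** * Passage to the limit *)

Lemma archi_mul (R : archiRealFieldType) (c eps : R) :
  0 <= c -> 0 < eps -> exists b : nat, c < b%:R * eps.
Proof.
move=> c0 eps0; exists (Num.bound (c / eps)).
by rewrite -ltr_pdivrMr // archi_boundP // divr_ge0 // ltW.
Qed.

(** The error is at most [32 n^2 / (4 t)], where [32 n^2 <= 2048 k^2] and [4 t >= (2/3) k^3]. This
    gives [3072 / k], which is below [eps] once [k >= b]. *)
Lemma ratio_near_quarter (R : realFieldType) (eps : R) (i t n k b : nat) :
    (n <= 8 * k)%N -> (0 < k)%N -> (b <= k)%N -> 0 < eps -> 3072 < b%:R * eps ->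
    (k ^ 3 <= 6 * t)%N -> `|4 * i%:R - t%:R| <= 32 * n%:R ^+ 2 :> int ->
  `|i%:R / t%:R - 1 / 4| < eps.
Proof.
rewrite -(ler_nat R) -(ltr_nat R) -(ler_nat R b) -(ler_nat R (k ^ 3)) natrX !natrM.
rewrite -(ler_int R) intr_norm rmorphB !rmorphM /= !rmorph_nat.
move: (i%:R) (t%:R) (n%:R) (k%:R) (b%:R) (ler0n R n) => {}i {}t {}n {}k {}b n0.
move=> nk k0 bk eps0 epsb kt it.
have epsk : 3072 < eps * k by rewrite (lt_le_trans epsb) // mulrC ler_pM2l.
have t0 : 0 < t by have := exprn_gt0 3 k0; lra.
have -> : i / t - 1 / 4 = (4 * i - t) / (4 * t) by field; rewrite gt_eqF.
have t4 : 0 < 4 * t by lra.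
rewrite normrM normfV (gtr0_norm t4) ltr_pdivrMr //; apply: le_lt_trans it _.
have : n ^+ 2 <= (8 * k) ^+ 2 by rewrite lerXn2r ?nnegrE //; lra.
have : 3072 * k ^+ 2 < eps * k ^+ 3 by rewrite (exprS k 2) (mulrA eps) ltr_pM2r ?exprn_gt0.
have : eps * k ^+ 3 <= eps * (6 * t) by rewrite ler_wpM2l // ltW.
by lra.
Qed.

(* lim_{n -> oo} |I_n| / |T_n| = 1/4, as an epsilon-N statement over rat. *)
Theorem mainTheorem4 :
  forall eps : rat, 0 < eps ->
  exists N : nat, forall n : nat, (N <= n)%N ->
    `|diceRatio n - 1 / 4%:R| < eps.
Proof.
move=> eps eps0.
have [b bP] := archi_mul _ _ _ (ler0n _ 3072) eps0.
(* With [k = n %/ 4], the term 44 gives [k >= 11], hence [3 * k + 11 <= 4 * k <= n], and [4 * b]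
   gives [b <= k]. *)
exists (4 * b + 44)%N => n Nn; pose k := (n %/ 4)%N.
apply: (ratio_near_quarter _ _ _ _ n k b _ _ _ eps0 bP).
- by rewrite /k; lia.
- by rewrite /k; lia.
- by rewrite /k; lia.
- by apply: card_Tset_ge; rewrite /k; lia.
exact: card_Iset_Tset.
Qed.
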